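(* The only bases $\beta$ with $2 \le \beta < 1441440$ for which there is no interesting reversed sum-product pair are $$2,3,4,5,6,7,8,9,12,15,21.$$ (That is, there is no interesting reversed sum-product pair for each of these bases, and there is at least one for every other base $2 \le \beta < 1441440$.)
   Context: A base-$\beta$ representation of a positive integer is canonical if it has no leading zero. A pair of positive integers $a \le b$ is a reversed sum-product pair for the base $\beta$ if the canonical base-$\beta$ representations of $a+b$ and $ab$ are the reverse of each other as digit strings (in particular they have the same number of digits). A reversed sum-product pair $(a,b)$ for the base $\beta$ is called interesting if it is neither $(2,2)$ nor $(\beta-1,\beta-1)$. *)

(* Defs.v *)
From Stdlib Require Import ZArith List.
Import ListNotations.
Open Scope Z_scope.

(* Digit strings are lists of integers, most significant digit first. *)
Definition digits_value (beta : Z) (s : list Z) : Z :=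
  fold_left (fun v d => v * beta + d) s 0.

(* [hd 0 s <> 0] also forces [s] to be nonempty: for beta >= 2 every positive
   integer has exactly one canonical representation, and 0 has none. *)
Definition canonical_repr (beta n : Z) (s : list Z) : Prop :=
  Forall (fun d => 0 <= d < beta) s /\ hd 0 s <> 0 /\ digits_value beta s = n.

Definition reversed_sum_product_pair (beta a b : Z) : Prop :=
  0 < a /\ a <= b /\
  exists s t : list Z,
    canonical_repr beta (a + b) s /\ canonical_repr beta (a * b) t /\ t = rev s.

Definition interesting_pair (beta a b : Z) : Prop :=
  reversed_sum_product_pair beta a b /\
  (a, b) <> (2, 2) /\ (a, b) <> (beta - 1, beta - 1).

(* Main.v *)
(* With [s = a + b] the condition reads [rev s = a s - a^2]. For fixed [a], match
   the digits of [s] from both ends at once: the state is the pair of a low carry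
   and a high carry, starting from [(- a^2, 0)], and each step consumes one digit
   at either end, until both carries agree (even length) or one middle digit
   makes them compatible (odd length).

   Existence: for a fixed sequence of carries the digits are affine functions of
   [beta] along a residue class modulo [a^2 - 1], so one run gives solutions for
   all large [beta] in the class. Since 1441440 = 3 * 5 * 7 * 3 * 11 * 13 * 32,
   the runs with [a] = 2, 4, 6, 8, 10, 12, 14, 17 (whose moduli divide 1441440) leave
   few classes modulo 1441440, and the bases in these are sifted by further runs.

   Non-existence: comparing digit counts gives [a < 2 beta], and for each such
   [a] only finitely many states are reachable. *)
Require Import Defs.
From Stdlib Require Import ZArith List Lia Znumtheory.
Import ListNotations.
Open Scope bool_scope.
Open Scope Z_scope.

(** * Integer ranges and values of digit strings *)

Definition zrange (n : Z) : list Z := map Z.of_nat (seq 0 (Z.to_nat n)).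

Lemma in_zrange (n x : Z) : In x (zrange n) <-> 0 <= x < n.
Proof.
  unfold zrange. rewrite in_map_iff. split.
  - intros (k & <- & Hk). apply in_seq in Hk. lia.
  - intros H. exists (Z.to_nat x). rewrite in_seq. lia.
Qed.

Definition digit_string (beta : Z) (s : list Z) : Prop :=
  Forall (fun d => 0 <= d < beta) s.

Lemma digits_value_snoc (beta x : Z) (s : list Z) :
  digits_value beta (s ++ [x]) = digits_value beta s * beta + x.
Proof. unfold digits_value. now rewrite fold_left_app. Qed.

Lemma digits_value_cons (beta x : Z) (s : list Z) :
  digits_value beta (x :: s) = x * beta ^ Z.of_nat (length s) + digits_value beta s.
Proof.
  induction s as [|y s IH] using rev_ind.
  - unfold digits_value; cbn. lia.
  - change (x :: s ++ [y]) with ((x :: s) ++ [y]).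
    rewrite !digits_value_snoc, IH, length_app, Nat2Z.inj_add, Z.pow_add_r by lia.
    cbn [length]. change (Z.of_nat 1) with 1. ring.
Qed.

Lemma digits_value_bound (beta : Z) (s : list Z) :
  0 < beta -> digit_string beta s ->
  0 <= digits_value beta s < beta ^ Z.of_nat (length s).
Proof.
  intros Hb. induction s as [|x s IH]; intros H.
  - cbn. lia.
  - inversion_clear H as [|? ? Hx Hs]. specialize (IH Hs).
    rewrite digits_value_cons. cbn [length].
    rewrite Nat2Z.inj_succ, Z.pow_succ_r by lia. nia.
Qed.

(** A nonzero leading digit alone contributes [beta] to the power [length s - 1]; multiplying by
    [beta] avoids that subtraction in the exponent. *)
Lemma digits_value_lower (beta : Z) (s : list Z) :
  0 < beta -> digit_string beta s -> hd 0 s <> 0 ->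
  beta ^ Z.of_nat (length s) <= beta * digits_value beta s.
Proof.
  intros Hb H Hhd. destruct s as [|x s]; [easy|]. cbn in Hhd.
  inversion_clear H as [|? ? Hx Hs].
  pose proof (digits_value_bound beta s Hb Hs) as Hv.
  rewrite digits_value_cons. cbn [length].
  rewrite Nat2Z.inj_succ, Z.pow_succ_r by lia. nia.
Qed.

(** * Reversal under multiplication, digit by digit from both ends *)

(** Induction matching the way carries consume a string: one digit at either end. Two elements go at
    once, so it runs over a bound on the length. *)
Lemma two_ended_ind (P : list Z -> Prop) :
  P [] -> (forall x, P [x]) -> (forall y s x, P s -> P (y :: s ++ [x])) ->
  forall s, P s.
Proof.
  intros H0 H1 H2 s.
  assert (H : forall n s, (length s <= n)%nat -> P s); [|now apply (H (length s))].
  clear s. induction n as [|n IH]; intros s Hs.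
  - destruct s; [easy|cbn in Hs; lia].
  - destruct s as [|y s]; [easy|].
    destruct s as [|x s _] using rev_ind; [easy|].
    apply H2, IH. cbn in Hs. rewrite length_app in Hs. cbn in Hs. lia.
Qed.

(* Multiplying [s] by [a], with [c] carried into the lowest digit and [d] out
   of the highest one, gives the reverse of [s]. *)
Definition reversing (beta a c d : Z) (s : list Z) : Prop :=
  digit_string beta s /\
  a * digits_value beta s + c =
    digits_value beta (rev s) + beta ^ Z.of_nat (length s) * d.

Lemma digit_string_rev (beta : Z) (s : list Z) :
  digit_string beta s -> digit_string beta (rev s).
Proof. apply Forall_rev. Qed.

Lemma digit_string_ends (beta x y : Z) (s : list Z) :
  digit_string beta (y :: s ++ [x]) <->
  0 <= x < beta /\ 0 <= y < beta /\ digit_string beta s.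
Proof.
  unfold digit_string. rewrite Forall_cons_iff, Forall_app, Forall_cons_iff.
  split; [tauto|]. intros (Hx & Hy & Hs). repeat split; auto; tauto || lia.
Qed.

Lemma rev_ends (x y : Z) (s : list Z) : rev (y :: s ++ [x]) = x :: rev s ++ [y].
Proof. cbn. now rewrite rev_app_distr. Qed.

Lemma digits_value_ends (beta x y : Z) (s : list Z) :
  digits_value beta (y :: s ++ [x]) =
  (y * beta ^ Z.of_nat (length s) + digits_value beta s) * beta + x.
Proof.
  change (y :: s ++ [x]) with ((y :: s) ++ [x]).
  now rewrite digits_value_snoc, digits_value_cons.
Qed.

Lemma pow_length_ends (beta x y : Z) (s : list Z) :
  beta ^ Z.of_nat (length (y :: s ++ [x])) = beta * beta * beta ^ Z.of_nat (length s).
Proof.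
  cbn [length]. rewrite length_app. cbn [length].
  replace (Z.of_nat (S (length s + 1))) with (2 + Z.of_nat (length s)) by lia.
  rewrite Z.pow_add_r by lia. ring.
Qed.

Lemma reversing_nil (beta a c d : Z) : reversing beta a c d [] <-> c = d.
Proof.
  unfold reversing, digits_value; cbn [rev fold_left length].
  change (beta ^ Z.of_nat 0) with 1. split; [intros [_ H]; lia|].
  intros ->. split; [constructor|lia].
Qed.

Lemma reversing_single (beta a c d x : Z) :
  reversing beta a c d [x] <-> 0 <= x < beta /\ a * x + c = x + beta * d.
Proof.
  unfold reversing, digits_value, digit_string; cbn [rev app fold_left length].
  rewrite Forall_cons_iff. change (Z.of_nat 1) with 1. rewrite Z.pow_1_r.
  split; [intros [[Hx _] H]; lia|].
  intros [Hx H]. repeat split; auto; lia.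
Qed.

(** The hypotheses are the long-multiplication equations of the lowest and the highest place: [x] is
    multiplied to give [y] there, and [y] to give [x] here. Being an equivalence, it serves both to
    build strings and to strip them. *)
Lemma reversing_ends (beta a c d c1 d1 x y : Z) (s : list Z) :
  0 < beta -> a * x + c = y + beta * c1 -> x + beta * d = a * y + d1 ->
  (reversing beta a c d (y :: s ++ [x]) <->
   0 <= x < beta /\ 0 <= y < beta /\ reversing beta a c1 d1 s).
Proof.
  intros Hb Hlow Hhigh. unfold reversing.
  rewrite digit_string_ends, rev_ends, !digits_value_ends, pow_length_ends, length_rev.
  set (P := beta ^ _). set (v := digits_value beta s). set (w := digits_value beta (rev s)).
  (* The defect of the equation for the long string is [beta] times the defect for the inner one. *)
  assert (E : a * ((y * P + v) * beta + x) + c - ((x * P + w) * beta + y + beta * beta * P * d)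
              = beta * (a * v + c1 - (w + P * d1))).
  { replace d1 with (x + beta * d - a * y) by lia.
    replace (a * ((y * P + v) * beta + x) + c)
      with (a * (y * P + v) * beta + (a * x + c)) by ring.
    rewrite Hlow. ring. }
  split.
  - intros ((Hx & Hy & Hs) & H). repeat split; try tauto.
    apply Z.sub_move_0_r, (Z.mul_reg_l _ _ beta); lia.
  - intros (Hx & Hy & Hs & H). split; [tauto|].
    rewrite H, Z.sub_diag, Z.mul_0_r in E. lia.
Qed.

(** The low digit [x] determines everything else: [y] is the lowest digit of the product, hence the
    remainder of [a * x + c], and both inner carries follow. So a state has at most [beta]
    successors. *)
Lemma reversing_ends_inv (beta a c d x y : Z) (s : list Z) :
  0 < beta -> reversing beta a c d (y :: s ++ [x]) ->
  0 <= x < beta /\ y = (a * x + c) mod beta /\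
  reversing beta a ((a * x + c) / beta) (x + beta * d - a * ((a * x + c) mod beta)) s.
Proof.
  intros Hb H.
  assert (Hy : y = (a * x + c) mod beta).
  { destruct H as [Hs E]. apply digit_string_ends in Hs.
    rewrite rev_ends, !digits_value_ends, pow_length_ends in E.
    (* Modulo [beta] the equation of values reduces to [a * x + c] and [y]; the quotient collects
       all other terms. *)
    apply Z.mod_unique with
      (q := digits_value beta (rev s) + x * beta ^ Z.of_nat (length (rev s))
            + beta * beta ^ Z.of_nat (length s) * d
            - a * (y * beta ^ Z.of_nat (length s) + digits_value beta s)); lia. }
  rewrite (reversing_ends beta a c d ((a * x + c) / beta)
             (x + beta * d - a * ((a * x + c) mod beta)) x y s Hb) in H.
  - tauto.
  - pose proof (Z.div_mod (a * x + c) beta). lia.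
  - rewrite <- Hy. lia.
Qed.

(** Since [a * b = a * (a + b) - a ^ 2], the product is the sum multiplied by [a] with [- a ^ 2]
    carried in and nothing carried out. The leading digits of sum and product are the two ends of
    [s]. *)
Lemma reversed_pair_iff (beta a b : Z) :
  reversed_sum_product_pair beta a b <->
  0 < a <= b /\ exists s, reversing beta a (- a ^ 2) 0 s /\
    hd 0 s <> 0 /\ hd 0 (rev s) <> 0 /\ digits_value beta s = a + b.
Proof.
  unfold reversed_sum_product_pair, canonical_repr, reversing. split.
  - intros (Ha & Hab & s & t & (Hs & Hhs & Vs) & (Ht & Hht & Vt) & ->).
    split; [lia|]. exists s. rewrite Vs, Vt. repeat split; auto. ring.
  - intros (Hab & s & (Hs & E) & Hhs & Hhr & Vs).
    split; [lia|]. split; [lia|]. exists s, (rev s).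
    repeat split; auto; [now apply digit_string_rev|]. rewrite Vs in E.
    replace (digits_value beta (rev s)) with (a * (a + b) + - a ^ 2) by lia. ring.
Qed.

(** * Existence: one run of carries gives pairs in a whole residue class of bases *)

(** Tests that the solution of [m * x = u * beta - w] is an integer digit, at least [lo]. The bounds
    on the slope [u / m] keep it a digit in larger bases of the class. *)
Definition digit_ok (lo beta m u w : Z) : bool :=
  (0 <=? u) && (u <=? m) && ((u * beta - w) mod m =? 0) &&
  (lo * m <=? u * beta - w) && (u * beta - w <? m * beta).

(** Raising the base by [m * k] raises the digit by [u * k], which lies between [0] and [m * k]. *)
Lemma digit_ok_shift (lo beta m u w k : Z) :
  0 < m -> 0 <= k -> digit_ok lo beta m u w = true ->
  exists x, m * x = u * (beta + m * k) - w /\ lo <= x < beta + m * k.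
Proof.
  unfold digit_ok. rewrite !Bool.andb_true_iff, !Z.leb_le, Z.ltb_lt, Z.eqb_eq.
  intros Hm Hk ((((Hu & Hum) & Hmod) & Hlo) & Hhi).
  apply Z.mod_divide in Hmod; [|lia]. destruct Hmod as [x0 Hx0].
  exists (x0 + u * k). split; [lia|nia].
Qed.

(* [cs] lists the carries out of the successive low digits. Eliminating one of
   the outer digits [x] (low) and [y] (high) from the two carry equations gives
   [(a^2 - 1) x = a (beta c1 - c) + beta d - d1] and
   [(a^2 - 1) y = a (beta d - d1) + beta c1 - c]. The first one fixes [d1]
   modulo [a^2 - 1], and both digits are affine in [beta] along a residue class
   modulo [a^2 - 1]. The bound [lo] makes the outermost digits nonzero. *)
Fixpoint carries_ok (lo beta a c d : Z) (cs : list Z) : bool :=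
  let m := a ^ 2 - 1 in
  match cs with
  | [] =>
      (c =? d) ||
      ((0 <=? d) && digit_ok 0 beta (a - 1) d c)
  | c1 :: cs' =>
      let z := (a * (beta * c1 - c) + beta * d) mod m in
      let d1 := if z <=? a then z else z - m in
      digit_ok lo beta m (a * c1 + d) (a * c + d1) &&
      digit_ok lo beta m (a * d + c1) (a * d1 + c) &&
      carries_ok 0 beta a c1 d1 cs'
  end.

(** The carries stay the same in every base of the class while the digits move affinely, so a check
    in the single base [beta] gives a string for each [k]. *)
Lemma carries_ok_reversing (a beta k : Z) (cs : list Z) :
  2 <= a -> 0 < beta -> 0 <= k ->
  forall lo c d, 0 <= lo -> carries_ok lo beta a c d cs = true ->
  exists s, reversing (beta + (a ^ 2 - 1) * k) a c d s /\
    (cs <> [] -> (2 <= length s)%nat /\ lo <= hd 0 s /\ lo <= hd 0 (rev s)).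
Proof.
  intros Ha Hb Hk. assert (Hm : 0 < a ^ 2 - 1) by nia.
  induction cs as [|c1 cs IH]; intros lo c d Hlo H.
  - cbn in H. apply Bool.orb_true_iff in H as [H|H].
    + apply Z.eqb_eq in H. exists []. now rewrite reversing_nil.
    + apply Bool.andb_true_iff in H as [_ H].
      (* A middle digit solves [(a - 1) * x = beta * d - c], with modulus [a - 1] only; a shift of
         the base by [(a ^ 2 - 1) * k] is [(a + 1) * k] of these. *)
      apply (digit_ok_shift _ _ _ _ _ ((a + 1) * k)) in H as (x & Hx & Hr); [|lia|nia].
      replace ((a - 1) * ((a + 1) * k)) with ((a ^ 2 - 1) * k) in * by ring.
      exists [x]. split; [|easy]. rewrite reversing_single. split; [exact Hr|lia].
  - cbn [carries_ok] in H.
    set (d1 := if _ <=? a then _ else _) in H.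
    rewrite !Bool.andb_true_iff in H. destruct H as ((Hx & Hy) & H).
    apply IH in H as (s & Hs & _); [|lia].
    apply (digit_ok_shift _ _ _ _ _ k) in Hx as (x & Hx & Hxr); [|lia|lia].
    apply (digit_ok_shift _ _ _ _ _ k) in Hy as (y & Hy & Hyr); [|lia|lia].
    set (beta' := beta + (a ^ 2 - 1) * k) in *.
    assert (0 < beta') by nia.
    exists (y :: s ++ [x]). split.
    (* [a] times one eliminated equation minus the other is a carry equation multiplied by
       [a ^ 2 - 1], which is positive and cancels. *)
    + rewrite (reversing_ends _ _ _ _ c1 d1); [|lia|nia|nia].
      repeat split; try lia; apply Hs.
    + intros _. rewrite rev_ends. cbn [length hd]. rewrite length_app. cbn. lia.
Qed.

(* [(r, q, cs)], attached to a summand [a], stands for the carries [cs] in every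
   base [beta >= (a^2 - 1) q + r] with [beta] congruent to [r] modulo [a^2 - 1]. *)
Definition family := (Z * Z * list Z)%type.

(** A nonempty run yields a sum of at least two digits, hence at least [beta]. Then [2 * a <= beta]
    gives [a <= b] and, with [5 <= beta], excludes both trivial pairs. *)
Definition family_ok (a : Z) (f : family) : bool :=
  let '(r, q, cs) := f in
  let beta := (a ^ 2 - 1) * q + r in
  (2 <=? a) && (2 * a <=? beta) && (5 <=? beta) && negb (length cs =? 0)%nat &&
  carries_ok 1 beta a (- a ^ 2) 0 cs.

Definition group_ok (g : Z * list family) : bool :=
  forallb (family_ok (fst g)) (snd g).

Definition covers (g : Z * list family) (beta : Z) : bool :=
  let m := fst g ^ 2 - 1 in
  let z := beta mod m in
  existsb (fun '(r, q, _) => (r =? z) && (m * q + r <=? beta)) (snd g).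

Lemma covers_interesting (g : Z * list family) (beta : Z) :
  group_ok g = true -> covers g beta = true -> exists a b, interesting_pair beta a b.
Proof.
  destruct g as [a fs]. unfold group_ok, covers. cbn [fst snd].
  rewrite forallb_forall, existsb_exists. intros Hok (((r, q), cs) & Hin & H).
  apply Hok in Hin. unfold family_ok in Hin.
  rewrite !Bool.andb_true_iff, !Z.leb_le, Bool.negb_true_iff, Nat.eqb_neq in Hin.
  destruct Hin as ((((Ha & Hab) & H5) & Hcs) & Hc).
  rewrite Bool.andb_true_iff, Z.eqb_eq, Z.leb_le in H. destruct H as [Hr Hge].
  set (beta0 := (a ^ 2 - 1) * q + r) in *.
  assert (Hm : 0 < a ^ 2 - 1) by nia.
  (* [k] counts the periods [a ^ 2 - 1] between the least base of the family and [beta]. *)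
  set (k := beta / (a ^ 2 - 1) - q).
  assert (Hk : beta = beta0 + (a ^ 2 - 1) * k).
  { pose proof (Z.div_mod beta (a ^ 2 - 1)). unfold beta0, k. lia. }
  assert (Hk0 : 0 <= k) by nia.
  apply (carries_ok_reversing a beta0 k) in Hc as (s & Hs & Hends); try lia.
  rewrite <- Hk in Hs.
  destruct Hends as (Hlen & Hhd & Hlast); [now intros ->|].
  (* At least two digits with a nonzero leading one. *)
  assert (Hv : beta <= digits_value beta s).
  { apply (Z.mul_le_mono_pos_l _ _ beta); [lia|].
    transitivity (beta ^ Z.of_nat (length s)).
    - replace (beta * beta) with (beta ^ 2) by ring. apply Z.pow_le_mono_r; lia.
    - apply digits_value_lower; [lia|apply Hs|lia]. }
  exists a, (digits_value beta s - a). split; [|split].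
  - apply reversed_pair_iff. split; [lia|]. exists s. repeat split; try apply Hs; lia.
  - intros [= H1 H2]. lia.
  - intros [= H1 H2]. lia.
Qed.

(** * Sieving bases and residue classes *)

(** Taking the groups in turn lets each scan only what the earlier ones left. *)
Definition sift (gs : list (Z * list family)) (L : list Z) : list Z :=
  fold_left (fun L' g => filter (fun x => negb (covers g x)) L') gs L.

Lemma not_covered_sift (gs : list (Z * list family)) (L : list Z) (beta : Z) :
  In beta L ->
  (exists g, In g gs /\ covers g beta = true) \/
  In beta (sift gs L).
Proof.
  revert L. induction gs as [|g gs IH]; intros L HL; [now right|]. cbn [fold_left].
  destruct (covers g beta) eqn:Hg; [left; exists g; cbn; auto|].
  destruct (IH (filter (fun x => negb (covers g x)) L)) as [(g' & Hin & Hg')|H].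
  - apply filter_In. now rewrite Hg.
  - left. exists g'. cbn; auto.
  - now right.
Qed.

Definition meets_residue (g : Z * list family) (x : Z) : bool :=
  let z := x mod (fst g ^ 2 - 1) in
  existsb (fun '(r, _, _) => r =? z) (snd g).

Definition split_classes (M p : Z) (L : list Z) : list Z :=
  flat_map (fun R => map (fun i => R + M * i) (zrange p)) L.

(* Thresholds [q] are ignored here: [splitting_ok] bounds them all by [N0]. *)
Fixpoint uncovered_classes (M : Z) (L : list Z) (st : list (Z * (Z * list family)))
  : list Z :=
  match st with
  | [] => L
  | (p, g) :: st' =>
      uncovered_classes (M * p)
        (filter (fun x => negb (meets_residue g x)) (split_classes M p L)) st'
  end.

Fixpoint splitting_ok (N0 N M : Z) (st : list (Z * (Z * list family))) : bool :=
  match st with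
  | [] => M =? N
  | (p, (a, fs)) :: st' =>
      (0 <? p) && (1 <? a) && ((M * p) mod (a ^ 2 - 1) =? 0) &&
      forallb (fun '(r, q, _) => (a ^ 2 - 1) * q + r <=? N0) fs &&
      splitting_ok N0 N (M * p) st'
  end.

(** In mixed radix, [beta mod (M * p)] is [beta mod M] plus [M] times the next digit
    [(beta / M) mod p]. *)
Lemma in_split_classes (M p beta : Z) (L : list Z) :
  0 < M -> 0 < p -> In (beta mod M) L -> In (beta mod (M * p)) (split_classes M p L).
Proof.
  intros HM Hp H. apply in_flat_map. exists (beta mod M). split; [easy|].
  apply in_map_iff. exists ((beta / M) mod p). rewrite in_zrange. split.
  - symmetry. apply Z.rem_mul_r; lia.
  - now apply Z.mod_pos_bound.
Qed.

(** At each stage the class of [beta] either meets a family, whose threshold [beta >= N0] exceeds or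
    attains, or survives to be split further. Covered classes are discarded before splitting, so the
    bases below [N] need not be enumerated one by one. *)
Lemma uncovered_classes_complete (N0 N beta : Z) (st : list (Z * (Z * list family))) :
  N0 <= beta ->
  forall M L, 0 < M -> splitting_ok N0 N M st = true -> In (beta mod M) L ->
  (exists g, In g (map snd st) /\ covers g beta = true) \/
  In (beta mod N) (uncovered_classes M L st).
Proof.
  intros Hbeta. induction st as [|(p, (a, fs)) st IH]; intros M L HM Hok HL.
  - cbn in Hok. apply Z.eqb_eq in Hok. subst N. now right.
  - cbn [splitting_ok] in Hok.
    rewrite !Bool.andb_true_iff, !Z.ltb_lt, Z.eqb_eq, forallb_forall in Hok.
    destruct Hok as ((((Hp & Ha) & Hdiv) & Hq) & Hok).
    assert (Hm : 0 < a ^ 2 - 1) by nia.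
    apply Z.mod_divide in Hdiv; [|lia].
    apply (in_split_classes M p) in HL; [|lia|lia].
    destruct (meets_residue (a, fs) (beta mod (M * p))) eqn:Hmeet.
    + left. exists (a, fs). split; [now left|].
      unfold meets_residue in Hmeet. unfold covers. cbn [fst snd] in *.
      rewrite existsb_exists in *. destruct Hmeet as (((r, q), cs) & Hin & Hr).
      exists (r, q, cs). split; [easy|].
      (* As [a ^ 2 - 1] divides [M * p], reducing the class gives the residue of [beta] itself. *)
      rewrite <- Zmod_div_mod in Hr by (lia || easy).
      rewrite Hr. specialize (Hq _ Hin). cbn in Hq |- *.
      apply Z.leb_le in Hq. apply Z.leb_le. lia.
    + cbn [uncovered_classes].
      destruct (IH (M * p) (filter (fun x => negb (meets_residue (a, fs) x))
                              (split_classes M p L))) as [(g & Hin & Hg)|H].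
      * lia.
      * easy.
      * apply filter_In. now rewrite Hmeet.
      * left. exists g. cbn; auto.
      * now right.
Qed.

(** * The runs used *)

(* Both tables come from a computer search: for each [a] a shortest run per residue
   class, and for [sporadic_table] a greedy choice of runs covering what is left. *)
Definition splitting_table : list (Z * (Z * list family)) :=
  [
    (3, (2, [(1, 3, [1])]));
    (5, (4, [(3, 1, [1]); (6, 2, [3]); (9, 1, [2; 0]); (11, 0, [2])]));
    (7, (6, [(5, 1, [1]); (8, 2, [5; 2]); (10, 1, [4; 2; 3]); (13, 1, [4]); (15, 1, [5]);
      (17, 0, [1]); (20, 0, [2; 2; 4; 0]); (22, 1, [5; 3]); (23, 0, [2]); (25, 0, [3; 3; 4; 1]);
      (27, 0, [3; 0; 2]); (29, 0, [3]); (32, 0, [4])]));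
    (3, (8, [(5, 1, [3]); (7, 1, [1]); (10, 2, [7; 3; 6]); (14, 1, [5; 7]);
      (17, 1, [6; 3; 2; 0; 5]); (19, 1, [7; 4]); (25, 0, [5; 4]); (26, 0, [3]); (28, 1, [7]);
      (33, 0, [5]); (35, 0, [2; 4; 4; 2; 6; 0]); (37, 1, [7; 2; 4]); (38, 0, [6; 1]);
      (39, 0, [2]); (44, 0, [5; 5]); (46, 1, [7; 5]); (47, 0, [3]); (51, 0, [4]);
      (53, 0, [4; 0; 3; 1]); (55, 0, [4]); (59, 0, [4]); (61, 0, [4; 1])]));
    (11, (10, [(3, 1, [3]); (9, 1, [1]); (12, 2, [9; 4; 8; 3]); (14, 1, [7; 9; 4; 5; 8]);
      (18, 1, [6; 3]); (21, 1, [8; 3]); (24, 1, [7]); (27, 0, [4; 3; 0]); (36, 0, [3; 0]);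
      (39, 0, [1; 7; 4; 6]); (42, 1, [8; 9; 0]); (45, 1, [9]); (47, 1, [8]); (48, 0, [7; 8; 1]);
      (51, 0, [6]); (54, 0, [2; 6; 4; 4; 6; 2; 8; 0]); (59, 0, [2]); (63, 0, [8; 6; 0]);
      (72, 0, [7; 0]); (74, 0, [2; 1]); (78, 1, [9; 7; 5]); (81, 0, [5; 4]); (84, 0, [4]);
      (87, 0, [5; 0; 4; 1; 3]); (89, 0, [5]); (93, 0, [5; 5; 7; 2])]));
    (13, (12, [(11, 1, [1]); (14, 2, [11; 5; 10; 4; 9]); (19, 1, [10]); (22, 1, [7; 10; 5; 11]);
      (25, 1, [10; 3; 6; 7; 2; 0; 9; 4]); (27, 1, [11; 3; 6]); (33, 1, [9; 2]);
      (38, 0, [5; 2; 2; 5; 10; 8; 7; 0; 4]); (40, 1, [11; 2; 4; 6]); (41, 1, [9; 4; 4; 10]);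
      (47, 0, [1]); (51, 0, [7; 9; 8; 8]); (53, 1, [11; 8; 5; 2]); (55, 0, [8; 7; 4]);
      (57, 0, [5; 7]); (58, 0, [8; 4; 3; 1; 10]); (61, 0, [8]); (64, 0, [8]); (66, 1, [11]);
      (68, 0, [7; 1; 1; 11; 0; 3]); (69, 0, [5]); (75, 1, [10; 1; 7; 8; 4]);
      (77, 0, [2; 8; 4; 6; 6; 4; 8; 2; 10; 0]); (79, 1, [11; 7; 3; 10; 6]); (81, 0, [10]);
      (82, 0, [9; 3]); (83, 0, [2]); (85, 0, [7; 3; 2]); (90, 0, [9; 5; 3; 0; 8; 6; 2]);
      (92, 1, [11; 6]); (94, 0, [9; 4]); (95, 0, [1]); (97, 0, [7; 11; 4]); (103, 0, [3; 6]);
      (105, 1, [11; 4]); (107, 0, [3]); (110, 0, [4; 7]); (112, 0, [10]); (113, 0, [4; 10]);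
      (114, 0, [7]); (115, 0, [3]); (116, 0, [4; 4; 10]); (118, 1, [11; 9; 7]); (119, 0, [4]);
      (121, 0, [6; 11]); (123, 0, [3]); (127, 0, [6; 3]); (128, 0, [8; 8; 6]);
      (129, 0, [6; 0; 5; 1; 4; 2]); (131, 0, [6]); (134, 0, [4; 8]); (137, 0, [8]);
      (139, 0, [9])]));
    (1, (14, [(5, 1, [11; 2; 0; 11; 5]); (9, 1, [3; 8; 8; 7]); (11, 1, [5]); (13, 1, [1]);
      (16, 2, [13; 6; 12; 5; 11; 4]); (22, 1, [12; 4]); (29, 1, [12; 3; 8]);
      (31, 1, [13; 8; 3]); (32, 1, [10; 1]); (33, 1, [8; 2]); (34, 1, [9; 12]); (43, 1, [11]);
      (44, 0, [6; 2]); (46, 1, [13; 9]); (47, 0, [8; 12; 12]); (50, 0, [5]); (55, 0, [1; 1]);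
      (58, 0, [6; 1]); (59, 0, [4; 6; 10; 0; 3; 7; 9; 1]); (61, 1, [13; 7]); (73, 0, [4]);
      (74, 0, [3; 8; 7; 4; 11; 0; 2; 9; 6]); (76, 1, [13; 10; 7]); (80, 0, [8]); (81, 0, [11]);
      (87, 0, [8]); (89, 0, [5]); (91, 1, [13]); (97, 0, [1; 10]); (100, 0, [11; 1]);
      (104, 0, [2; 10; 4; 8; 6; 6; 8; 4; 10; 2; 12; 0]); (106, 1, [13; 4; 8; 12; 3; 7]);
      (109, 0, [6; 2]); (110, 0, [10; 13; 8; 7; 0; 1; 7; 8; 11; 5; 10; 12; 7]); (111, 0, [2]);
      (119, 0, [11; 5; 5; 11]); (121, 1, [13; 2; 4; 6]); (124, 0, [11; 12; 12]); (128, 0, [5]);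
      (132, 0, [2; 10; 3; 3]); (133, 0, [9; 6]); (134, 0, [8; 11; 9; 10; 10]);
      (136, 1, [13; 3; 6; 9; 12]); (138, 0, [11]); (139, 0, [2]);
      (149, 0, [10; 7; 2; 2; 7; 10; 12; 5; 4; 0; 9]); (151, 1, [13; 5; 10; 2; 7]);
      (153, 0, [2]); (160, 0, [4]); (162, 0, [11; 5]);
      (164, 0, [9; 9; 12; 6; 2; 3; 5; 0; 8; 10]); (166, 1, [13; 11; 9; 7]); (167, 0, [5]);
      (169, 0, [7; 5; 9; 13]); (173, 0, [7; 2; 10; 5; 5; 2; 6]); (174, 0, [6; 2]);
      (175, 0, [7; 7]); (176, 0, [11; 8; 5; 6; 9]); (179, 0, [7; 0; 6; 1; 5; 2; 4]);
      (181, 0, [7]); (188, 0, [8])]));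
    (32, (17, [(2, 1, [8; 4]); (4, 1, [4]); (6, 1, [14]); (8, 1, [2; 13; 3; 4; 13; 1; 8]);
      (12, 1, [7; 6; 4; 0]); (14, 1, [6]); (16, 1, [1]); (40, 1, [11; 4; 4]); (42, 0, [2]);
      (44, 1, [15; 12]); (52, 1, [14; 3; 12; 12; 4]); (58, 0, [7]); (62, 0, [6]); (66, 0, [10]);
      (70, 1, [15; 2; 4; 3; 6; 9; 1]); (76, 0, [4; 0]); (84, 0, [1; 9; 12]); (88, 0, [5; 8]);
      (110, 0, [6]); (132, 0, [5]); (142, 0, [13; 14]); (146, 0, [8; 0; 8]); (148, 0, [4]);
      (150, 0, [14]); (152, 0, [2; 14; 12; 12; 14; 10; 16]); (154, 0, [11; 7; 10; 10; 12]);
      (158, 0, [6]); (166, 0, [15; 12; 3; 7]); (172, 0, [13]); (174, 0, [11]); (186, 0, [2]);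
      (196, 0, [7; 1]); (206, 0, [6]); (210, 0, [10]); (214, 0, [11; 7; 9; 14; 5; 14; 1; 1]);
      (218, 0, [8; 2; 3; 14; 15; 12; 16; 12; 2; 15; 16; 14; 5; 6]);
      (236, 0, [15; 3; 9; 8; 14; 6; 12; 13; 11; 1; 0; 0]); (242, 0, [7; 3; 15; 13; 2]);
      (248, 0, [14; 0]); (254, 0, [6])]))
  ].

Definition sporadic_table : list (Z * list family) :=
  [
    (16, [(5, 1, [3; 7]); (15, 1, [1]); (23, 1, [9; 10]); (27, 1, [10; 8]);
      (53, 0, [6; 14; 10; 2; 12; 1; 5]); (60, 1, [13; 6; 13; 14; 11; 15]);
      (65, 1, [12; 7; 15; 8; 7; 5; 7; 6; 5; 10]); (75, 0, [7; 13; 12; 13; 7; 14; 5; 10]);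
      (77, 0, [6; 15; 9; 8; 8; 10]); (87, 1, [13; 1; 3; 1; 11; 0]);
      (92, 0, [9; 8; 4; 12; 0; 3; 11; 14; 14; 4]); (95, 0, [1; 4]); (105, 0, [5; 5; 14; 3; 15]);
      (107, 1, [14]); (113, 0, [11; 6; 2]); (120, 1, [15]); (122, 0, [3; 9; 9; 8; 1; 11; 5]);
      (125, 0, [13; 7]); (132, 1, [14; 10; 2]);
      (135, 0, [2; 12; 4; 10; 6; 8; 8; 6; 10; 4; 12; 2; 14; 0]);
      (140, 0, [14; 10; 4; 9; 2; 4; 4; 14; 11]); (143, 0, [2]); (150, 0, [12; 15]);
      (155, 0, [11]); (162, 0, [6]); (177, 0, [9; 8; 1; 3; 6; 13; 8]);
      (182, 0, [7; 13; 0; 14; 9; 13; 14]); (195, 0, [4; 15]); (207, 0, [4]);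
      (215, 0, [2; 14; 11]); (222, 1, [15; 13; 11; 9]); (227, 0, [4; 1]);
      (233, 0, [8; 8; 13; 1; 14; 13; 8; 6; 9; 10; 2]); (237, 0, [8; 0; 7; 1; 6; 2; 5; 3]);
      (239, 0, [8]); (245, 0, [8; 8; 8; 7])]);
    (18, [(5, 1, [7; 5; 4; 8; 1; 0; 3; 11; 13]); (17, 1, [1]);
      (20, 2, [17; 8; 16; 7; 15; 6; 14; 5]); (25, 1, [5]); (32, 1, [14; 4]);
      (34, 1, [10; 5; 4; 0]); (37, 1, [16; 3; 12; 7]); (39, 1, [17; 5; 10; 15]);
      (44, 1, [11; 12]); (47, 0, [8; 13]); (49, 1, [15; 7; 9; 14]);
      (56, 0, [8; 2; 5; 5; 2; 8; 16; 11; 13; 14; 10; 0; 7; 3]); (61, 1, [15]); (64, 0, [7]);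
      (65, 1, [16; 5; 14]); (68, 0, [5; 9; 0]); (77, 1, [17; 6]); (80, 0, [13; 6; 9]);
      (85, 0, [4; 0]); (88, 0, [11; 14]); (94, 0, [4; 10; 10; 4; 16]);
      (96, 1, [17; 2; 4; 6; 8]); (104, 0, [5]); (105, 0, [7; 8; 16; 11; 16; 7; 1; 15]);
      (106, 0, [11]); (110, 1, [15; 9; 14; 11]); (113, 0, [10; 15; 11; 14; 12; 13; 13]);
      (115, 1, [17; 4; 8; 12; 16; 3; 7]); (132, 0, [14; 7; 6; 15; 15; 6]);
      (134, 1, [17; 14; 11; 8; 5; 2]); (139, 0, [8]); (145, 0, [12]); (147, 0, [5]);
      (148, 0, [8]); (149, 0, [13; 9]); (150, 0, [11]); (151, 0, [12]); (153, 1, [17]);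
      (161, 0, [1; 15]); (165, 0, [10; 8]); (167, 0, [13]);
      (170, 0, [2; 14; 4; 12; 6; 10; 8; 8; 10; 6; 12; 4; 14; 2; 16; 0]);
      (172, 1, [17; 11; 5; 16; 10; 4; 15; 9]); (173, 0, [14; 14; 1]); (174, 0, [10; 4; 9]);
      (179, 0, [2]); (182, 0, [7; 13]); (183, 0, [15]); (187, 0, [7; 2; 8; 9]);
      (191, 1, [17; 13; 9]); (192, 0, [10; 5; 2; 10; 10]); (197, 0, [2; 14; 4]);
      (208, 0, [5; 8; 13; 0; 4; 9; 12; 1; 3; 10]); (210, 1, [17; 9]);
      (213, 0, [8; 14; 6; 7; 12; 2]); (221, 0, [3; 8; 6; 7; 6; 8; 3; 16; 1]);
      (229, 1, [17; 3; 6; 9]); (233, 0, [3]); (235, 0, [10; 10; 12; 14]); (236, 0, [13; 1]);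
      (238, 0, [15; 8; 0]); (240, 0, [16]); (242, 0, [2]); (243, 0, [11; 9; 12; 4]);
      (244, 0, [10]); (246, 0, [7; 4; 2; 9; 14; 14; 9; 2; 4; 7; 16; 12; 11; 0; 6]);
      (248, 1, [17; 10; 3; 13; 6; 16; 9]); (255, 0, [14; 0]); (260, 0, [4]); (261, 0, [11]);
      (263, 0, [3; 1]); (265, 0, [13; 9; 3]); (267, 1, [17; 7; 14]);
      (274, 0, [11; 2; 7; 8; 14]); (275, 0, [6]); (276, 0, [13; 8; 13]);
      (281, 0, [3; 7; 17; 4; 8; 1]); (284, 0, [6; 6; 16; 13; 9; 3; 2; 10; 12; 0; 5; 7; 15]);
      (286, 1, [17; 15; 13; 11; 9]); (287, 0, [6]); (289, 0, [9; 6; 2; 3; 17]); (299, 0, [9]);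
      (303, 0, [9; 0; 8; 1; 7; 2; 6; 3; 5]); (305, 0, [9]); (311, 0, [9]); (314, 0, [12]);
      (317, 0, [6])]);
    (22, [(21, 1, [1]);
      (56, 0, [9; 6; 14; 14; 3; 17; 14; 17; 16; 3; 21; 10; 3; 14; 1; 11; 16; 8; 20]);
      (63, 0, [8; 21]); (72, 0, [7; 15]); (84, 0, [6; 5; 2; 21]); (93, 1, [21; 16; 11]);
      (95, 0, [3; 14; 2; 20; 14]); (98, 0, [15; 14; 16; 21; 15; 20; 8]); (105, 0, [14; 21]);
      (114, 0, [5; 12]);
      (119, 1, [19; 10; 6; 15; 16; 3; 7; 14; 4; 12; 8; 14; 10; 15; 0; 2; 7; 8; 20]);
      (128, 0, [6; 1]); (147, 0, [10; 6; 10; 20; 8; 3; 19; 2]); (168, 0, [3; 12; 2; 0]);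
      (191, 1, [20]); (203, 0, [8]); (210, 0, [7; 14]); (219, 0, [1; 18; 9; 1; 12; 3]);
      (231, 1, [21]); (243, 0, [14; 2; 9]);
      (252, 0, [2; 18; 4; 16; 6; 14; 8; 12; 10; 10; 12; 8; 14; 6; 16; 4; 18; 2; 20; 0]);
      (261, 0, [18]); (263, 0, [2]); (273, 0, [16; 5]); (282, 0, [13]);
      (315, 0, [20; 18; 12; 19; 0]); (327, 0, [19]); (338, 0, [5; 14; 4; 19; 2; 1]);
      (359, 0, [17; 21; 8; 5; 6; 4; 10; 7; 1; 8; 4; 13; 11]); (371, 0, [20; 2; 4; 10]);
      (399, 0, [17; 17; 20; 15; 5; 19; 21]);
      (401, 0, [15; 9; 18; 2; 8; 16; 15; 11; 19; 11; 2; 15; 6; 0; 9; 8; 11; 7]);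
      (420, 0, [15; 14; 11; 11; 14; 15; 20; 13; 21]); (422, 0, [18; 13; 9; 7]);
      (441, 0, [11; 7; 14]); (455, 0, [11; 0; 0; 13; 0; 7]); (461, 0, [11])]);
    (20, [(9, 1, [11; 1; 11; 3; 2; 18; 15; 3]); (62, 0, [9; 2; 6]); (72, 1, [18]); (74, 0, [7]);
      (83, 0, [6; 8; 16; 17; 7; 7; 17]); (86, 1, [16; 6; 10; 18; 10; 6; 8; 1]);
      (93, 0, [3; 15]); (116, 0, [11; 14; 0; 5; 8]); (117, 0, [15; 19; 5; 14]);
      (135, 0, [13; 13; 3; 1; 17; 15; 4; 12; 12]); (146, 0, [3; 14; 7; 10]); (149, 0, [17]);
      (158, 0, [13; 19; 0; 4; 4; 4; 19; 15; 17; 16; 2; 8; 4; 19; 17; 6]); (177, 0, [16; 16]);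
      (188, 0, [7]); (203, 0, [17]); (219, 0, [2]); (230, 0, [17; 5; 11; 11; 5; 17]);
      (245, 0, [7]); (261, 0, [12; 6]); (275, 0, [14; 1]); (293, 0, [16; 7]);
      (327, 0, [5; 17; 1]); (329, 0, [2]); (338, 0, [18]); (345, 0, [17; 6; 17; 18; 0; 13; 16]);
      (348, 0, [9; 15]); (350, 0, [11; 15; 17; 0; 17; 5]); (359, 0, [7]);
      (371, 0, [10; 10; 18]); (387, 0, [5]); (389, 0, [12])]);
    (26, [(5, 1, [5]); (23, 1, [9]); (42, 1, [21; 7; 19]); (47, 1, [16]);
      (50, 1, [14; 7; 7; 14; 24; 12; 8; 22; 19; 20; 9; 0]); (60, 1, [16; 15]);
      (92, 1, [22; 20; 19; 23; 9; 16]); (95, 0, [3; 10; 0]); (110, 1, [21; 17; 22; 4; 6; 2; 5]);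
      (120, 0, [8; 7; 24; 1; 0; 1; 21; 12; 10]); (122, 0, [10; 8; 14; 21; 9; 10]);
      (137, 0, [18; 1]); (140, 0, [5; 0]);
      (155, 0, [1; 11; 21; 13; 24; 18; 17; 13; 11; 6; 23; 1; 14; 12; 7; 14; 5]);
      (158, 1, [23; 18; 17; 5; 21; 3]); (173, 0, [9]); (192, 0, [5; 23]); (210, 0, [11]);
      (240, 0, [4; 1]); (248, 0, [9]); (257, 0, [20; 3; 8]); (267, 0, [14]); (275, 0, [5; 25]);
      (282, 0, [22; 9; 15; 12; 13]); (320, 0, [3; 12; 22; 1; 10; 25]); (392, 0, [10; 2]);
      (398, 0, [9]); (410, 0, [5; 2; 14; 21; 23; 3; 6; 24; 12; 25; 0]); (417, 0, [16]);
      (455, 0, [19; 3; 18; 10]); (473, 0, [9]); (477, 0, [16]);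
      (480, 0, [2; 19; 9; 2; 16; 6; 9]); (500, 0, [23; 16; 16; 23; 24; 21; 8; 13; 19; 11; 0]);
      (560, 0, [7; 5]); (563, 0, [16; 6; 13; 0; 9; 1; 2]); (570, 0, [23; 9; 7; 10]);
      (605, 0, [23; 15; 1; 20]); (623, 0, [9]); (662, 0, [16])]);
    (24, [(7, 1, [17; 16; 12]); (13, 1, [11; 8; 15; 17; 16; 4; 9]); (38, 1, [17; 18; 21]);
      (58, 1, [19; 18; 4; 3; 1]); (63, 1, [19; 20; 6]); (65, 0, [14]); (67, 0, [10; 10; 22]);
      (79, 0, [10; 4]); (87, 1, [19; 1]); (130, 0, [14]); (138, 1, [21; 14; 12; 11]);
      (142, 0, [14; 15]); (157, 0, [9; 17]); (195, 0, [7]); (212, 0, [20; 3; 14]);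
      (232, 0, [19; 21; 15; 22; 18; 6; 17; 4; 11; 8; 21]); (243, 0, [21]);
      (253, 0, [16; 4; 2; 21]); (257, 0, [11; 5]); (258, 0, [13; 19; 7]);
      (262, 0, [16; 8; 7; 11]); (265, 0, [16]); (274, 0, [16]); (297, 0, [10; 11]);
      (308, 0, [21; 16]); (310, 0, [17; 7; 19; 11; 11; 19; 7]); (313, 0, [15; 7; 12]);
      (335, 0, [1; 6]); (337, 0, [15; 8]); (343, 0, [22; 10; 6; 23; 12; 15; 16; 18; 21]);
      (354, 0, [18]); (363, 0, [13; 16; 7; 0; 3; 16]); (368, 0, [11; 19; 17; 6]);
      (370, 0, [18; 13]); (377, 0, [19; 9; 14; 14; 16]); (387, 0, [13; 16; 17; 11; 18; 7]);
      (388, 0, [5; 11]); (407, 0, [3]); (412, 0, [5; 1]); (422, 0, [13]); (442, 0, [20; 11]);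
      (447, 0, [3; 6; 20; 15]); (453, 0, [11; 23; 20; 5; 10; 11; 19; 15; 8; 18]); (455, 0, [4]);
      (462, 0, [7]); (465, 0, [22; 21; 15; 2; 10]); (478, 0, [21; 5; 8; 16; 13; 22]);
      (483, 0, [6; 9; 7; 16]); (485, 0, [4; 23; 9; 0; 9; 18; 18; 1; 21]);
      (497, 0, [4; 13; 16; 2; 17]); (502, 0, [22; 9; 18; 2; 18; 7; 15]); (503, 0, [6]);
      (512, 0, [8; 18]); (518, 0, [8; 11; 4; 9; 23; 18; 2]); (527, 0, [8]); (533, 0, [12]);
      (542, 0, [8]); (545, 0, [12; 8; 13]); (547, 0, [12; 6; 22]); (563, 0, [16]);
      (567, 0, [18]); (569, 0, [12])]);
    (28, [(5, 1, [11; 19; 9; 24; 4; 17; 20]); (11, 1, [5; 3; 2]); (23, 1, [17; 10; 24; 10]);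
      (74, 0, [17]); (93, 0, [3; 9]); (123, 0, [15]); (132, 0, [18; 9]); (137, 0, [10; 3; 8]);
      (155, 0, [11; 10; 14; 26; 18; 19]); (164, 0, [15; 2; 7; 22]); (234, 0, [19]);
      (243, 0, [13; 22; 5]); (249, 0, [21; 3]); (254, 0, [12; 4; 11]); (255, 1, [25; 5; 13]);
      (257, 0, [21; 24; 12; 6; 14; 10]); (258, 0, [22; 11; 21; 2; 14; 23; 7]);
      (264, 0, [9; 0; 9]); (281, 0, [20; 19; 7; 18; 18; 17; 13; 21; 17]); (299, 1, [26]);
      (302, 0, [20]); (333, 0, [22; 5]); (338, 0, [23; 7]); (353, 0, [8; 1]); (354, 0, [3]);
      (366, 0, [11; 6]); (378, 1, [27]); (419, 0, [2]); (438, 0, [6]); (455, 0, [11]);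
      (461, 0, [2; 23; 4; 27; 21; 23; 12; 10]); (470, 0, [26; 22; 27; 26; 20; 19]);
      (501, 0, [24; 18]); (506, 0, [21; 15; 14]); (515, 0, [24; 1; 11]);
      (524, 0, [23; 2; 15; 16; 8]); (527, 0, [26; 16]); (545, 0, [2; 7]);
      (569, 0, [23; 21; 9; 18; 10; 15; 22; 11; 8; 25]); (570, 0, [13]); (576, 0, [10]);
      (579, 0, [17; 21]); (582, 0, [16; 16; 6; 17; 2; 19]);
      (587, 0, [3; 12; 6; 1; 21; 25; 11; 11; 8; 23; 18; 10]); (615, 0, [4]); (648, 0, [23; 0]);
      (650, 0, [4; 11; 12; 21; 19; 3; 4; 13; 5; 27; 20; 27; 20]); (671, 0, [4; 22]);
      (707, 0, [7; 4]); (713, 0, [8]); (734, 0, [8; 25]); (759, 0, [14; 7; 2]); (762, 0, [16])]);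
    (32, [(17, 1, [15; 27; 31; 28; 18; 19]); (29, 1, [11]); (98, 0, [15; 2; 12; 5; 9]);
      (105, 0, [14]); (122, 0, [11]); (159, 0, [1; 28]); (164, 0, [23; 17; 5]);
      (191, 0, [1; 3]); (195, 0, [20; 17]); (215, 0, [11]);
      (230, 0, [5; 22; 13; 14; 21; 6; 29; 29; 6; 21; 14]); (251, 0, [27; 7]); (269, 0, [12]);
      (287, 0, [1; 21]); (293, 0, [18; 19]);
      (296, 0, [27; 9; 17; 19; 7; 29; 28; 8; 18; 18; 8; 28]); (308, 0, [11]);
      (327, 0, [13; 8; 1]);
      (329, 0, [24; 15; 8; 0; 23; 16; 7; 1; 22; 17; 6; 2; 21; 18; 5; 3; 20]);
      (359, 0, [26; 28; 21; 29]); (362, 0, [3; 26; 7; 22; 11; 18; 15]); (374, 0, [20]);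
      (393, 0, [17]); (395, 0, [14; 4; 9; 9; 4; 14; 30; 19; 25]); (401, 0, [11]);
      (419, 0, [28; 7]); (420, 0, [29]); (426, 0, [3; 27]); (467, 0, [23; 27; 27]);
      (492, 0, [23]); (494, 0, [11]); (515, 0, [9; 25; 25; 30]); (530, 0, [19]);
      (554, 0, [3; 13]); (564, 0, [14]); (591, 0, [2; 23]); (593, 0, [20; 23; 27; 16; 3; 9]);
      (680, 0, [11]); (689, 0, [9; 18]); (728, 0, [22; 1]); (731, 0, [15; 7; 26; 29]);
      (750, 0, [26; 16; 4]); (752, 0, [21; 16]); (758, 0, [7; 18]); (816, 0, [19]);
      (818, 0, [17; 4; 4]); (824, 0, [9; 14; 25; 29; 10; 13; 26; 28; 11; 12; 27; 27; 12]);
      (855, 0, [4; 8]); (890, 0, [25; 13; 11; 27]); (951, 0, [12]); (959, 0, [11]);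
      (966, 0, [23]); (989, 0, [16; 0; 15; 1; 14; 2; 13; 3; 12; 4; 11; 5; 10; 6; 9; 7]);
      (1007, 0, [20])]);
    (30, [(11, 1, [19]); (29, 1, [1]); (61, 1, [28; 3; 24; 7; 20; 11; 16]); (158, 0, [22; 8]);
      (163, 1, [25; 9; 2; 12]); (172, 1, [27; 4; 9]); (176, 0, [8; 16; 1]);
      (178, 0, [17; 10; 24]); (199, 0, [14; 20; 7; 11]); (216, 0, [24; 11]); (218, 1, [29; 10]);
      (222, 0, [22; 16; 2; 26; 20; 6; 24; 7]); (244, 0, [21]); (271, 0, [23; 8; 20; 10]);
      (316, 0, [22]); (327, 0, [23; 14; 7; 19]); (338, 0, [25]); (350, 0, [25; 21; 17; 15]);
      (351, 0, [14]); (352, 0, [8; 13; 21]); (367, 0, [8]); (377, 0, [12; 0]); (381, 0, [21]);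
      (384, 0, [27; 5; 19]); (394, 0, [27; 20; 0; 8; 25; 18]); (397, 0, [8; 9]);
      (419, 0, [1; 26]); (428, 0, [7; 23]); (433, 0, [20]); (435, 1, [29]); (453, 0, [17]);
      (461, 0, [26; 15]); (475, 0, [27; 29; 4; 26; 16]); (479, 0, [2]); (488, 0, [28]);
      (516, 0, [9; 2; 14]); (520, 0, [17; 23]); (522, 0, [19; 24; 0]); (535, 0, [7]);
      (536, 0, [9]); (537, 0, [25; 11; 0; 22]); (538, 0, [22]); (549, 0, [28; 16]);
      (551, 0, [18; 0]); (571, 0, [18; 25; 1]); (590, 1, [29; 15]); (596, 0, [27]);
      (629, 0, [3]); (648, 0, [16]); (663, 0, [8]); (669, 0, [3; 12]); (704, 0, [4]);
      (729, 0, [3; 14]); (733, 0, [13; 6; 9; 17; 15]); (737, 0, [5; 13]); (745, 1, [29; 6; 12]);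
      (746, 0, [19]); (749, 0, [5]); (779, 0, [6]); (785, 0, [5; 8]); (787, 0, [19]);
      (799, 0, [9; 5]); (809, 0, [4]); (812, 0, [10; 15; 14]); (829, 0, [9]); (830, 0, [10]);
      (839, 0, [10]); (843, 0, [15; 5; 7]); (849, 0, [6; 7]); (857, 0, [20; 8; 4; 19]);
      (859, 0, [15; 21]); (869, 0, [15]); (893, 0, [25])]);
    (11, [(8, 1, [4]); (32, 0, [1; 10]); (68, 0, [4])]);
    (34, [(158, 0, [23; 0; 26]); (203, 0, [1; 1]);
      (222, 0, [28; 10; 7; 33; 12; 19; 0; 19; 8; 17; 15; 2; 22]); (497, 0, [19; 0; 14]);
      (567, 0, [13]); (702, 0, [12; 26; 7]); (737, 0, [23]);
      (812, 0, [31; 11; 8; 5; 4; 3; 4; 18; 2; 17; 6; 19; 16; 28; 25; 13; 25; 15; 21; 19; 14; 1; 9; 33; 25; 7; 14]);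
      (882, 0, [28; 30; 22; 33; 4; 2; 9; 26; 30; 17; 10]);
      (1052, 0, [32; 19; 33; 8; 30; 0; 4; 0; 0; 32; 22; 23; 7; 26; 11])]);
    (3, [(2, 1, [1])]);
    (36, [(35, 1, [1]); (175, 0, [15; 20]); (245, 0, [16; 25; 10]); (308, 0, [16; 33; 28]);
      (322, 0, [21]); (438, 1, [34; 5; 0; 15]); (490, 0, [8; 3; 32]); (532, 0, [19; 16]);
      (599, 0, [23]); (613, 0, [24]); (630, 1, [35]); (669, 0, [10; 7]);
      (674, 0, [19; 27; 33; 7]); (683, 0, [2]); (772, 0, [13; 31]);
      (835, 0, [14; 13; 18; 1; 13; 22; 23; 6; 33; 0]); (912, 0, [34]); (922, 0, [19]);
      (963, 1, [35; 12]); (973, 0, [20; 17; 35]); (984, 0, [31; 16; 18]); (1017, 0, [11]);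
      (1115, 0, [6]); (1197, 0, [29]); (1259, 0, [18])]);
    (5, [(14, 0, [2])]);
    (7, [(6, 1, [1]); (20, 0, [1; 1])]);
    (44, [(290, 0, [37]); (317, 0, [24; 4; 23; 2; 10]); (417, 0, [29]); (428, 0, [15]);
      (650, 1, [41]); (752, 0, [40; 6]); (815, 0, [15]); (1005, 0, [34]); (1073, 0, [15]);
      (1137, 0, [7; 19]); (1202, 0, [15]); (1335, 0, [28]); (1397, 0, [30; 1]);
      (1410, 0, [16; 20; 13; 28]); (1460, 0, [15]); (1478, 0, [23; 4]); (1737, 0, [8]);
      (1847, 0, [15]); (1875, 0, [11; 16; 1]); (1913, 0, [28]);
      (1919, 0, [22; 6; 40; 0; 13; 37])]);
    (46, [(45, 1, [1]); (285, 0, [15]); (290, 0, [26]); (302, 0, [7; 39; 2]); (357, 0, [34]);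
      (434, 0, [25; 44; 36; 22]); (578, 0, [28; 6; 8]); (660, 0, [31]); (668, 0, [17]);
      (767, 1, [44]); (839, 0, [8]); (1035, 1, [45]); (1067, 0, [29]); (1094, 0, [34; 35; 8]);
      (1103, 0, [2]); (1152, 0, [36]); (1200, 0, [30]);
      (1235, 0, [36; 20; 40; 8; 31; 6; 20; 25]); (1379, 0, [2; 10; 20; 37]); (1454, 0, [8; 7]);
      (1500, 0, [16]); (1632, 0, [4]); (1793, 0, [3; 34]); (1902, 0, [19; 24]);
      (1994, 0, [38])]);
    (50, [(387, 0, [39]); (567, 0, [29]); (569, 0, [39; 28]); (611, 0, [40; 19]);
      (884, 0, [32]); (915, 0, [26]); (977, 0, [31]); (1187, 0, [24]); (1220, 0, [39]);
      (1269, 0, [41]); (1313, 0, [48; 34; 19]); (1358, 0, [35]); (1523, 0, [36; 15]);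
      (1934, 0, [23; 18]); (2303, 0, [38; 49]); (2424, 0, [20]); (2459, 0, [25]);
      (2489, 0, [10])]);
    (38, [(35, 1, [13]); (107, 0, [22; 34; 30]); (141, 0, [14]); (252, 0, [11; 5]);
      (257, 0, [13]); (350, 0, [23; 29]); (368, 0, [13]); (428, 0, [11; 16; 31; 33; 14]);
      (452, 0, [31]); (575, 0, [21]); (701, 0, [13]); (717, 0, [17]); (896, 0, [5; 28; 13; 20]);
      (923, 0, [13]); (945, 0, [35]); (1034, 0, [13]); (1049, 0, [16]); (1112, 0, [7; 34]);
      (1145, 0, [13]); (1256, 0, [13]); (1335, 0, [32]); (1367, 0, [13]); (1424, 0, [24]);
      (1433, 0, [19; 1])]);
    (42, [(234, 1, [40; 30]); (268, 1, [39]); (293, 0, [1]); (316, 0, [17]); (381, 0, [26]);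
      (436, 0, [31]); (456, 0, [22]); (494, 0, [13]); (523, 0, [37; 19]); (648, 0, [32]);
      (670, 0, [26]); (732, 1, [41; 15; 30; 4; 19; 34]); (841, 0, [28]); (999, 0, [10]);
      (1027, 0, [15; 35]); (1079, 0, [17]); (1152, 0, [27]); (1162, 1, [41; 21]);
      (1259, 0, [3; 31; 16]); (1341, 0, [19]); (1402, 0, [35]); (1431, 0, [33]);
      (1455, 0, [3; 19; 11; 21]); (1469, 0, [1]); (1492, 0, [11; 6]);
      (1549, 1, [41; 9; 18; 27; 36; 4; 13; 22; 31; 40; 8; 17; 26; 35; 3; 12; 21]);
      (1567, 0, [9; 37])]);
    (48, [(205, 1, [44]); (385, 0, [41]); (410, 1, [44]); (632, 0, [29; 0; 17]);
      (700, 0, [39; 4]); (709, 0, [36; 38]); (725, 0, [18; 39]); (786, 0, [34; 10; 35]);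
      (849, 0, [23]); (854, 0, [20]); (923, 0, [21; 6; 14]); (954, 0, [43; 28]);
      (1288, 0, [13]); (1313, 0, [30; 24]); (1369, 0, [30; 11]); (1600, 0, [46]);
      (1775, 0, [4]); (1804, 0, [25; 16; 21]); (1822, 0, [40; 27]); (1859, 0, [4]);
      (2095, 0, [9]); (2223, 0, [18]); (2249, 0, [24; 8]); (2279, 0, [32])]);
    (56, [(53, 1, [19]); (383, 0, [19]); (548, 0, [19]); (713, 0, [19]); (917, 0, [21]);
      (1703, 0, [19]); (2033, 0, [19]); (2198, 0, [19]); (2340, 0, [10]); (2363, 0, [19]);
      (2610, 0, [45]); (2693, 0, [19]); (3023, 0, [19])]);
    (40, [(39, 1, [1]); (476, 0, [11]); (489, 0, [30]); (582, 0, [25; 20]); (645, 0, [37]);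
      (746, 0, [3; 10]); (780, 1, [39]); (839, 0, [2]); (936, 0, [12; 9; 30]);
      (1016, 0, [12; 1]); (1050, 0, [15]); (1395, 1, [39; 28; 17; 6]); (1439, 0, [8]);
      (1575, 0, [25]); (1589, 0, [32])]);
    (52, [(773, 0, [31; 33; 4; 38; 32; 25; 35]); (842, 0, [10; 37]); (1088, 0, [29; 22]);
      (1133, 0, [5]); (1448, 0, [28; 31]); (1751, 0, [35]); (1832, 0, [41]);
      (1862, 0, [28; 10]); (1865, 0, [33; 49]); (1944, 0, [10]); (2201, 0, [35; 19]);
      (2391, 0, [6]); (2417, 0, [8]); (2495, 0, [7; 10]); (2651, 0, [26])]);
    (66, [(152, 1, [56; 45]); (377, 0, [14]); (413, 0, [54]); (777, 0, [49]);
      (972, 0, [26; 35]); (1212, 0, [19]); (1523, 0, [37; 11; 40]); (1562, 0, [61; 24; 13]);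
      (1633, 0, [4]); (1768, 0, [34; 0]); (2062, 0, [24]); (2103, 0, [62]); (2415, 0, [15]);
      (2465, 0, [42; 19; 55]); (2987, 0, [41]); (3328, 0, [39]); (3332, 0, [4]);
      (3465, 0, [41]); (3478, 0, [55; 3; 12]); (3798, 0, [34])]);
    (54, [(53, 1, [1]); (678, 1, [50]); (748, 0, [21]); (862, 0, [32]); (1063, 0, [26]);
      (1147, 0, [8]); (1189, 0, [38]); (1342, 0, [43]); (1390, 0, [24]); (1417, 0, [28; 38]);
      (1757, 0, [31]); (1780, 0, [39]); (1895, 0, [19]); (2032, 0, [28]); (2432, 0, [38]);
      (2667, 0, [32; 49]); (2912, 0, [36; 5])]);
    (60, [(467, 0, [42]); (522, 0, [37; 12; 45; 35; 29]); (1082, 0, [52]); (1128, 0, [36; 55]);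
      (1431, 0, [21]); (1559, 0, [1]); (1785, 0, [29; 41]); (2023, 0, [11]); (2279, 0, [2]);
      (2775, 0, [19]); (2841, 0, [22]); (2887, 0, [23; 21]); (2988, 0, [43; 33; 9]);
      (3299, 0, [10]); (3384, 0, [12; 27]); (3419, 0, [15]); (3429, 0, [6]); (3434, 0, [16]);
      (3459, 0, [18]); (3474, 0, [24; 3]); (3551, 0, [30; 40; 26])]);
    (68, [(1472, 0, [23]); (1874, 0, [23]); (1946, 0, [8]); (2075, 0, [23]); (2564, 0, [35]);
      (2889, 0, [2]); (3008, 0, [49]); (3165, 0, [9; 39; 39; 43; 5; 35]); (3281, 0, [23]);
      (3578, 0, [62; 16; 40]); (3837, 0, [41; 66; 17]); (4283, 0, [3]); (4538, 0, [32]);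
      (4572, 0, [36; 48])]);
    (86, [(353, 0, [38; 58]); (1052, 0, [64; 2; 74; 80]); (2123, 0, [29]); (2378, 0, [29]);
      (2730, 0, [4; 56; 27; 63]); (2775, 0, [11]); (3590, 0, [40]); (4928, 0, [29]);
      (5183, 0, [29]); (6203, 0, [29]); (7082, 0, [25; 27]); (7137, 0, [11]); (7352, 0, [56])]);
    (13, [(12, 1, [1]); (30, 0, [6]); (32, 0, [2; 11; 12; 8; 5; 4; 0; 9; 11])]);
    (58, [(98, 1, [42; 15; 11]); (242, 1, [46; 26; 2]); (327, 0, [25]); (425, 0, [3; 16]);
      (437, 1, [54; 22]); (852, 0, [36]); (881, 0, [36; 21; 11; 55]); (1166, 0, [9; 25]);
      (1211, 0, [35]); (1259, 0, [14]); (1944, 0, [55; 50; 46]); (2000, 0, [2; 1]);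
      (2328, 0, [40]); (2723, 0, [53]); (2855, 0, [46; 22])]);
    (62, [(263, 0, [37; 22; 46]); (1001, 0, [20]); (1157, 0, [21]); (1407, 0, [20]);
      (1523, 0, [21]); (2027, 0, [47; 7; 42; 30]); (2387, 0, [49; 53; 27]); (2804, 0, [21]);
      (3098, 0, [52])]);
    (102, [(286, 0, [46]); (992, 0, [11]); (2072, 0, [19]); (2588, 0, [64]); (3896, 0, [25]);
      (4003, 0, [8]); (4666, 0, [4]); (5722, 0, [87]); (6533, 0, [18]); (6648, 0, [93; 81]);
      (6680, 0, [2]); (7336, 0, [98]); (9349, 0, [9]); (9426, 0, [19]); (9438, 0, [39]);
      (9891, 0, [100; 31])]);
    (92, [(485, 0, [11]); (707, 0, [35]); (2993, 0, [82; 11; 68; 68]); (3059, 0, [63]);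
      (4664, 0, [57; 48]); (4949, 0, [40; 43; 84]); (5072, 0, [73]); (6804, 0, [29]);
      (7847, 0, [56]); (7982, 0, [35; 33; 13]); (8003, 0, [4])]);
    (108, [(530, 0, [76]); (833, 0, [7; 104]); (978, 0, [71; 36]); (1171, 0, [32; 32]);
      (1461, 0, [17]); (1801, 0, [62]); (2914, 0, [62; 41]); (4727, 0, [101]); (6193, 0, [23]);
      (8220, 0, [102]); (8589, 0, [101; 7]); (9431, 0, [3; 93]); (10193, 0, [98; 87; 75; 20]);
      (10608, 0, [52]); (11253, 0, [59; 79; 73; 20])]);
    (15, [(14, 1, [1]); (44, 0, [1; 9]); (104, 0, [1; 5; 3; 3]); (184, 0, [3; 14; 6])]);
    (70, [(69, 1, [1]); (1907, 0, [8]); (2390, 0, [60; 44; 56; 28; 62]); (2433, 0, [17; 60]);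
      (2435, 0, [29]); (2519, 0, [2]); (2535, 0, [18]); (3438, 0, [16]);
      (3906, 1, [69; 52; 35]); (4730, 0, [41]); (4859, 0, [14; 25])]);
    (84, [(640, 1, [79]); (2222, 0, [57]); (2512, 0, [11; 69; 32]); (2780, 0, [10; 50]);
      (4408, 0, [31]); (5487, 0, [3]); (6099, 0, [34; 16]); (6322, 0, [44; 34; 80]);
      (6457, 0, [75; 46]); (6654, 0, [31]); (6845, 0, [24]); (6947, 0, [21; 80; 19; 26])]);
    (23, [(156, 0, [5; 5]); (200, 0, [14]); (228, 0, [15; 1; 6; 5; 20; 4; 4]); (416, 0, [8]);
      (464, 0, [14])]);
    (64, [(1577, 0, [34; 22]); (2522, 0, [12; 50; 13; 13]); (3647, 0, [8])]);
    (82, [(201, 1, [62; 79]); (806, 0, [65]); (1199, 0, [8; 19]); (1635, 0, [69]);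
      (2603, 0, [8]); (2828, 0, [71]); (3443, 0, [2]); (3641, 0, [66; 19]); (5124, 0, [4]);
      (6168, 0, [39])]);
    (106, [(105, 1, [1]); (632, 0, [54; 46]); (2037, 0, [64]); (4979, 0, [83]); (5723, 0, [2]);
      (5933, 0, [43; 94]); (8582, 0, [33; 16; 5]); (9137, 0, [34; 1])]);
    (9, [(44, 0, [2; 6; 8]); (62, 0, [3])]);
    (29, [(72, 0, [2; 24; 24]);
      (432, 0, [12; 25; 15; 26; 22; 5; 11; 5; 18; 14; 7; 9; 16; 23; 5])]);
    (78, [(889, 0, [15]); (900, 0, [37]); (1201, 0, [65]); (2583, 0, [33; 58]);
      (2611, 0, [50; 15; 70]); (2965, 0, [52]); (3498, 0, [41; 57; 9]); (5210, 0, [67]);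
      (5485, 0, [9]); (5551, 0, [56])]);
    (74, [(254, 0, [30; 14]); (947, 0, [25]); (1277, 0, [50; 1]); (2540, 0, [3]);
      (2910, 0, [6]); (3575, 0, [25]); (3777, 0, [40])]);
    (80, [(77, 1, [27]); (551, 0, [27]); (1796, 0, [11]); (3632, 0, [27]); (4836, 0, [74]);
      (5423, 0, [5; 15]); (5679, 0, [8]); (5799, 0, [8]); (6219, 0, [20]); (6239, 0, [27])]);
    (90, [(1029, 0, [69]); (1591, 0, [75]); (1901, 0, [64]); (1927, 0, [58; 23]);
      (1946, 0, [48]); (2499, 1, [87]); (3325, 0, [59; 50; 18; 80; 22; 78]); (4519, 0, [46]);
      (5763, 0, [24]); (6293, 0, [58; 58])]);
    (96, [(2755, 0, [87; 8]); (4127, 0, [1]); (4145, 0, [66]);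
      (4277, 0, [79; 90; 50; 12; 37; 73]); (5192, 0, [56]); (8159, 0, [8]);
      (8773, 0, [43; 7; 89; 60; 41])]);
    (100, [(99, 1, [1]); (1446, 0, [52]); (1815, 0, [79; 70; 27; 99]); (2571, 0, [87]);
      (2684, 0, [89]); (4029, 0, [51; 25; 70; 62]); (5099, 0, [2]); (7821, 0, [78; 0]);
      (8849, 0, [8])]);
    (110, [(3377, 0, [37]); (5396, 0, [34; 56]); (5897, 0, [44; 9; 15]); (6245, 0, [9; 25]);
      (7301, 0, [37]); (7868, 0, [30]); (10889, 0, [1]); (11303, 0, [38])]);
    (112, [(261, 0, [3; 42]); (1748, 0, [23]); (1941, 0, [3; 12]); (4830, 0, [109]);
      (5240, 0, [19; 103]); (6287, 0, [65]); (7184, 0, [27; 91]); (8372, 0, [41]);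
      (9147, 0, [105]); (10328, 0, [9; 28])]);
    (114, [(113, 1, [1]); (1013, 0, [53]); (6075, 0, [109]); (6353, 0, [71; 41]);
      (7385, 0, [84]); (8327, 0, [101; 108; 68; 93; 18; 94; 82; 80]); (8412, 0, [83]);
      (8852, 0, [58]); (11030, 0, [42; 90; 59; 27; 97])]);
    (132, [(413, 0, [62]); (4141, 0, [126; 65]); (6249, 0, [32]); (11309, 0, [53]);
      (14651, 0, [6]); (15355, 0, [6; 122; 31; 19]); (15743, 0, [125]); (16470, 0, [50]);
      (17159, 0, [44])]);
    (21, [(20, 1, [1]); (292, 0, [16]); (412, 0, [9])]);
    (88, [(53, 1, [83; 1; 63; 19]); (831, 0, [54]); (2051, 0, [71]); (2577, 0, [66]);
      (3504, 0, [34]); (4755, 0, [73]); (5553, 0, [9]); (6065, 0, [85; 28])]);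
    (128, [(4697, 0, [43]); (7364, 0, [43]); (7371, 0, [95]); (11436, 0, [63; 15]);
      (11963, 0, [60]); (13460, 0, [43]); (15365, 0, [43]); (16055, 0, [32; 69; 97])]);
    (140, [(971, 0, [47]); (6686, 0, [104]); (9761, 0, [120]); (9854, 0, [131]);
      (10655, 0, [27]); (11957, 0, [17]); (14315, 0, [47]); (16817, 0, [47])]);
    (27, [(464, 0, [19; 23; 2]); (548, 0, [3; 15]); (632, 0, [25; 1; 13])]);
    (116, [(803, 0, [39]); (1838, 0, [39]); (2873, 0, [39]); (3218, 0, [39]); (3530, 0, [30]);
      (3908, 0, [39]); (9680, 0, [55])]);
    (118, [(117, 1, [1]); (8547, 0, [64; 93]); (9380, 0, [2; 37]); (9398, 0, [20; 19]);
      (10593, 0, [18]); (10722, 0, [93])]);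
    (124, [(2147, 0, [38]); (4170, 0, [19]); (4763, 0, [116]); (8183, 0, [1; 31]);
      (9855, 0, [79]); (12662, 0, [92; 113; 16; 8; 6; 119; 74]); (13577, 0, [8]);
      (14040, 0, [30; 15]); (14162, 0, [23])]);
    (138, [(901, 0, [17; 81]); (1853, 0, [21]); (2325, 0, [119]); (3260, 0, [8; 79]);
      (7302, 0, [107; 9; 115]); (18928, 0, [72])]);
    (31, [(30, 1, [1]); (380, 0, [11])]);
    (104, [(317, 0, [62]); (1337, 0, [35]); (1955, 0, [35]); (2573, 0, [35]); (10679, 0, [13]);
      (10763, 0, [68])]);
    (144, [(1625, 0, [14]); (2787, 0, [107; 1; 57]); (14757, 0, [126; 10]);
      (17220, 0, [129; 136; 131; 127]); (18177, 0, [102]); (18287, 0, [8])]);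
    (72, [(2297, 0, [55; 57]); (2607, 0, [65]); (2621, 0, [61]); (3959, 0, [4]); (4679, 0, [9]);
      (5123, 0, [36])]);
    (94, [(765, 0, [79]); (3338, 0, [68; 80; 4; 12; 80; 73]); (4430, 0, [15; 12; 23; 28]);
      (7388, 0, [86])]);
    (126, [(4215, 0, [66]); (4400, 0, [26]); (5583, 0, [32]); (7633, 0, [48; 49]);
      (12280, 0, [30]); (12743, 0, [92; 98]); (15190, 0, [87; 48])]);
    (130, [(1467, 0, [14; 76]); (3590, 0, [47; 104; 29; 40; 5]); (4244, 0, [54; 85]);
      (7023, 0, [76]); (8852, 0, [83; 64])]);
    (156, [(3914, 0, [22; 40; 53]); (11638, 0, [142]); (15985, 0, [72; 45; 142; 133]);
      (21157, 0, [51]); (23120, 0, [71])]);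
    (35, [(32, 1, [12]); (308, 0, [26; 26]); (480, 0, [11])]);
    (76, [(728, 0, [62]); (2783, 0, [32])]);
    (98, [(3587, 0, [33]); (4460, 0, [33]); (8544, 0, [83]); (9519, 0, [49])]);
    (136, [(5180, 0, [11]); (7812, 0, [36]); (8510, 0, [130; 83; 17]); (14753, 0, [62]);
      (17543, 0, [17]); (18110, 0, [71])]);
    (150, [(7320, 0, [91]); (8564, 0, [146]); (9079, 0, [119]); (19470, 0, [103; 101]);
      (21090, 0, [127; 78; 135])]);
    (158, [(464, 0, [95]); (8559, 0, [104]); (12680, 0, [39; 36]); (15698, 0, [53])]);
    (25, [(224, 0, [1; 7]); (524, 0, [5]); (536, 0, [21; 19])]);
    (134, [(5348, 0, [126]); (6867, 0, [8]); (9608, 0, [17])]);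
    (146, [(578, 0, [49]); (4055, 0, [89; 59; 75]); (4928, 0, [49])]);
    (148, [(9126, 0, [3]); (13727, 0, [118; 43]); (21434, 0, [71])]);
    (152, [(2075, 0, [23; 5]); (4874, 0, [119; 21]); (8420, 0, [141]); (13725, 0, [80]);
      (20081, 0, [51])]);
    (154, [(8363, 0, [26]); (16722, 0, [73])]);
    (160, [(159, 1, [1]); (5075, 0, [125]); (8747, 1, [158])]);
    (37, [(6, 1, [6]); (84, 1, [22; 14]); (420, 0, [25])]);
    (47, [(416, 0, [7; 46]); (872, 0, [16]); (1832, 0, [3; 4])]);
    (120, [(6855, 0, [62]); (9956, 0, [109; 91])]);
    (142, [(4739, 0, [56; 64; 113]); (7316, 0, [21; 115])]);
    (33, [(624, 0, [14; 2]); (752, 0, [21; 11])]);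
    (45, [(976, 0, [10; 22])]);
    (51, [(1980, 0, [31])]);
    (57, [(16, 1, [32])]);
    (61, [(60, 1, [1])]);
    (63, [(1808, 0, [51; 51])]);
    (87, [(4448, 0, [45; 12])]);
    (103, [(2478, 0, [66])]);
    (107, [(9644, 0, [36])]);
    (115, [(3312, 0, [91])]);
    (117, [(11468, 0, [41])]);
    (121, [(3344, 0, [94; 67; 53])]);
    (122, [(8780, 0, [36])]);
    (123, [(14144, 0, [4])]);
    (19, [(132, 0, [1; 15; 0])]);
    (73, [(1064, 0, [64; 32; 34; 69; 11])])
  ].

(** * Non-existence: exhausting the reachable carry states *)

Definition state := (Z * Z)%type.

(* A state reached with digits remaining has its high carry [d] in this range. *)
Definition viable (a : Z) (st : state) : bool :=
  let '(c, d) := st in (- (Z.abs c + 1) <=? d) && (d <=? a + Z.abs c).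

(** The inner carries of [reversing_ends_inv] when the low digit is [x]. *)
Definition peel (beta a : Z) (st : state) (x : Z) : state :=
  let '(c, d) := st in
  let t := a * x + c in (t / beta, x + beta * d - a * (t mod beta)).

Definition successors (beta a : Z) (st : state) : list state :=
  filter (viable a) (map (peel beta a st) (zrange beta)).

Definition no_middle_digit (beta a : Z) (st : state) : bool :=
  let '(c, d) := st in
  forallb (fun x => negb (a * x + c =? x + beta * d)) (zrange beta).

Definition state_mem (st : state) (V : list state) : bool :=
  existsb (fun st' => (fst st =? fst st') && (snd st =? snd st')) V.

(** A depth-first search whose result is not trusted: closure of the list is checked afterwards, so
    soundness does not rest on the search or on enough fuel. *)
Fixpoint reachable (beta a : Z) (fuel : nat) (todo V : list state) : list state :=
  match fuel with
  | O => V
  | S fuel' =>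
      match todo with
      | [] => V
      | st :: todo' =>
          if state_mem st V then reachable beta a fuel' todo' V
          else reachable beta a fuel' (successors beta a st ++ todo') (st :: V)
      end
  end.

Definition dead (beta a : Z) (V : list state) : bool :=
  forallb (fun st => negb (fst st =? snd st) && no_middle_digit beta a st &&
                     forallb (fun st' => state_mem st' V) (successors beta a st)) V.

(* The two trivial pairs have one and two digits. So a one- or two-digit sum is
   compared with them, and longer sums are followed through the carry states. *)
Definition no_summand (beta a : Z) : bool :=
  let start := (- a ^ 2, 0) in
  let W := filter (viable a)
             (map (peel beta a start)
                (filter (fun x => negb (x =? 0) && negb ((a * x - a ^ 2) mod beta =? 0))
                   (zrange beta))) in
  let V := reachable beta a 1000 (flat_map (successors beta a) W) [] in
  forallb (fun x => negb (a * x - a ^ 2 =? x) || ((a =? 2) && (x =? 4))) (zrange beta) &&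
  forallb (fun x =>
             let y := (a * x - a ^ 2) mod beta in
             let '(c, d) := peel beta a start x in
             (x =? 0) || (y =? 0) || negb (c =? d) ||
             ((a =? beta - 1) && (y * beta + x =? 2 * beta - 2))) (zrange beta) &&
  forallb (fun st => no_middle_digit beta a st &&
                     forallb (fun st' => state_mem st' V) (successors beta a st)) W &&
  dead beta a V.

(** Write [P] for the power of [beta] and [v], [w] for the two values, both in the range from [0] to
    [P - 1]. Then [d * P = a * v + c - w], and dividing by [P >= 1] bounds [d]. *)
Lemma reversing_viable (beta a c d : Z) (s : list Z) :
  0 < beta -> 0 < a -> reversing beta a c d s -> viable a (c, d) = true.
Proof.
  intros Hb Ha [Hs E]. unfold viable.
  pose proof (digits_value_bound beta s Hb Hs) as Hv.
  pose proof (digits_value_bound beta (rev s) Hb (digit_string_rev _ _ Hs)) as Hw.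
  rewrite length_rev in Hw. rewrite Bool.andb_true_iff, !Z.leb_le.
  set (P := beta ^ _) in *. split; nia.
Qed.

Lemma state_mem_In (st : state) (V : list state) : state_mem st V = true <-> In st V.
Proof.
  unfold state_mem. rewrite existsb_exists. destruct st as [c d]. split.
  - intros ((c', d') & Hin & H). cbn in H.
    rewrite Bool.andb_true_iff, !Z.eqb_eq in H. now destruct H as [-> ->].
  - intros H. exists (c, d). cbn. now rewrite !Z.eqb_refl.
Qed.

Lemma no_middle_digit_spec (beta a c d x : Z) :
  no_middle_digit beta a (c, d) = true -> ~ reversing beta a c d [x].
Proof.
  cbn. rewrite forallb_forall. intros H Hx. apply reversing_single in Hx as [Hx E].
  apply in_zrange, H in Hx. rewrite Bool.negb_true_iff, Z.eqb_neq in Hx. easy.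
Qed.

Lemma reversing_successor (beta a c d x y : Z) (s : list Z) :
  0 < beta -> 0 < a -> reversing beta a c d (y :: s ++ [x]) ->
  exists c1 d1, peel beta a (c, d) x = (c1, d1) /\ 0 <= x < beta /\
    y = (a * x + c) mod beta /\ viable a (c1, d1) = true /\ reversing beta a c1 d1 s.
Proof.
  intros Hb Ha H. apply reversing_ends_inv in H as (Hx & Hy & H); [|easy].
  eexists _, _. split; [reflexivity|]. eauto using reversing_viable.
Qed.

Lemma in_successors (beta a x : Z) (st st' : state) :
  peel beta a st x = st' -> 0 <= x < beta -> viable a st' = true ->
  In st' (successors beta a st).
Proof.
  intros <- Hx Hv. apply filter_In. split; [|easy]. apply in_map. now apply in_zrange.
Qed.

(** [V] is an invariant set: stripping both ends stays inside it, while neither the empty string nor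
    a single middle digit can finish from any of its states. *)
Lemma dead_spec (beta a : Z) (V : list state) (s : list Z) :
  0 < beta -> 0 < a -> dead beta a V = true ->
  forall c d, In (c, d) V -> ~ reversing beta a c d s.
Proof.
  intros Hb Ha HV. unfold dead in HV. rewrite forallb_forall in HV.
  induction s as [|x|y s x IH] using two_ended_ind; intros c d Hin H;
    specialize (HV _ Hin) as HV'; cbn [fst snd] in HV';
    rewrite !Bool.andb_true_iff in HV'; destruct HV' as ((Hcd & Hmid) & Hsucc).
  - apply reversing_nil in H. rewrite H, Z.eqb_refl in Hcd. discriminate.
  - now apply no_middle_digit_spec with (x := x) in Hmid.
  - apply reversing_successor in H as (c1 & d1 & Hp & Hx & _ & Hv & H); [|easy|easy].
    apply (IH c1 d1); [|easy].
    rewrite forallb_forall in Hsucc. apply state_mem_In, Hsucc.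
    eapply in_successors; eauto.
Qed.

(** Cases by the number of digits: one, two, three, at least four. The states [W] after the
    outermost digits are kept apart from [V], because only those digits must be nonzero and only
    there can equal carries come from an allowed pair. *)
Lemma no_summand_spec (beta a b : Z) :
  2 <= beta -> 0 < a -> no_summand beta a = true -> ~ interesting_pair beta a b.
Proof.
  intros Hb Ha Hno (Hpair & Hne2 & Hne1).
  apply reversed_pair_iff in Hpair as (Hab & s & Hs & Hhd & Hlast & Hv).
  unfold no_summand in Hno.
  set (W := filter (viable a) _) in Hno. set (V := reachable _ _ _ _ _) in Hno.
  rewrite !Bool.andb_true_iff in Hno. destruct Hno as (((H1 & H2) & HW) & HV).
  rewrite forallb_forall in H1, H2, HW.
  destruct s as [|x|y s x _] using two_ended_ind.
  - easy.
  - apply reversing_single in Hs as [Hx E]. cbn in Hv.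
    specialize (H1 x). rewrite in_zrange in H1. specialize (H1 Hx).
    rewrite Bool.orb_true_iff, Bool.negb_true_iff, Bool.andb_true_iff,
      Z.eqb_neq, !Z.eqb_eq in H1.
    (* The one exempted digit is the sum [4] with [a = 2], that is, the pair [(2, 2)]. *)
    destruct H1 as [H1|[-> ->]]; [lia|]. apply Hne2. f_equal; lia.
  - rewrite rev_ends in Hlast. cbn [hd] in Hhd, Hlast.
    apply reversing_successor in Hs as (c1 & d1 & Hp & Hx & Hy & Hvi & Hs); [|lia|lia].
    replace (a * x + - a ^ 2) with (a * x - a ^ 2) in Hy by ring.
    (* [x] and [y] lead the product and the sum, so both pass the nonzero filter. *)
    assert (HinW : In (c1, d1) W).
    { apply filter_In. split; [|easy]. rewrite <- Hp. apply in_map, filter_In.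
      rewrite in_zrange, <- Hy, Bool.andb_true_iff, !Bool.negb_true_iff, !Z.eqb_neq. tauto. }
    specialize (HW _ HinW). rewrite Bool.andb_true_iff in HW. destruct HW as [Hmid HW].
    destruct s as [|z|z' s z _] using two_ended_ind.
    (* Two digits: equal carries are exempted only for [a = beta - 1] with sum [2 * beta - 2], which
       forces [b = beta - 1]. *)
    + apply reversing_nil in Hs.
      specialize (H2 x). rewrite in_zrange in H2. specialize (H2 Hx).
      rewrite Hp, <- Hy in H2.
      rewrite !Bool.orb_true_iff, Bool.negb_true_iff, Bool.andb_true_iff,
        Z.eqb_neq, !Z.eqb_eq in H2.
      destruct H2 as [[[H2|H2]|H2]|[H2 H3]]; try easy.
      apply Hne1. cbn in Hv. f_equal; lia.
    + now apply (no_middle_digit_spec beta a c1 d1 z).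
    (* Four or more digits: a second pair of ends is stripped, and the state reached lies in [V]. *)
    + apply reversing_successor in Hs as (c2 & d2 & Hp2 & Hz & _ & Hv2 & Hs); [|lia|lia].
      apply (dead_spec beta a V s) with (c := c2) (d := d2); try easy; try lia.
      rewrite forallb_forall in HW. apply state_mem_In, HW.
      eapply in_successors; eauto.
Qed.

(** With [P] the power of [beta] for the common length, [a * b < P <= beta * (a + b) <= 2 * beta *
    b], and [b] cancels. *)
Lemma reversed_pair_summand_bound (beta a b : Z) :
  2 <= beta -> reversed_sum_product_pair beta a b -> 0 < a < 2 * beta.
Proof.
  intros Hb H. apply reversed_pair_iff in H as (Hab & s & (Hs & E) & Hhd & _ & Hv).
  pose proof (digits_value_lower beta s ltac:(lia) Hs Hhd) as Hlow.
  pose proof (digits_value_bound beta (rev s) ltac:(lia) (digit_string_rev _ _ Hs)) as Hup.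
  rewrite length_rev in Hup. rewrite Hv in *.
  set (P := beta ^ _) in *. nia.
Qed.

(** * Checks by evaluation, and the conclusion *)

Definition exceptional_bases : list Z := [2; 3; 4; 5; 6; 7; 8; 9; 12; 15; 21].

Definition all_groups : list (Z * list family) :=
  map snd splitting_table ++ sporadic_table.

Lemma tables_ok : forallb group_ok all_groups = true.
Proof. vm_compute. reflexivity. Qed.

(* 406 is the largest threshold [(a^2 - 1) q + r] in [splitting_table]. *)
Lemma splitting_table_ok : splitting_ok 406 1441440 1 splitting_table = true.
Proof. vm_compute. reflexivity. Qed.

(** Every listed value is at least 406, so the check says that none is left. Smaller ones are
    dropped because the class sieve ignores thresholds. *)
Lemma large_bases_covered :
  forallb (fun x => x <? 406)
    (sift sporadic_table
       (filter (fun x => 406 <=? x) (uncovered_classes 1 [0] splitting_table))) = true.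
Proof. vm_compute. reflexivity. Qed.

(** Below 406 each base is tested individually by [covers], which respects the thresholds. *)
Lemma small_bases_covered :
  forallb (fun x => (x <? 2) || existsb (Z.eqb x) exceptional_bases)
    (sift all_groups (zrange 406)) = true.
Proof. vm_compute. reflexivity. Qed.

Lemma exceptional_bases_dead :
  forallb (fun beta => (2 <=? beta) &&
             forallb (fun a => (a =? 0) || no_summand beta a) (zrange (2 * beta)))
    exceptional_bases = true.
Proof. vm_compute. reflexivity. Qed.

Lemma base_covered_or_exceptional (beta : Z) :
  2 <= beta < 1441440 ->
  (exists g, In g all_groups /\ covers g beta = true) \/ In beta exceptional_bases.
Proof.
  intros Hb. destruct (Z_lt_le_dec beta 406) as [Hlt|Hge].
  - destruct (not_covered_sift all_groups (zrange 406) beta) as [H|H].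
    + apply in_zrange. lia.
    + now left.
    + right. pose proof small_bases_covered as Hs. rewrite forallb_forall in Hs.
      apply Hs, Bool.orb_true_iff in H as [H|H]; [apply Z.ltb_lt in H; lia|].
      apply existsb_exists in H as (x & Hx & E). apply Z.eqb_eq in E. now subst x.
  - left. destruct (uncovered_classes_complete 406 1441440 beta splitting_table Hge 1 [0])
      as [(g & Hin & Hg)|H].
    + lia.
    + exact splitting_table_ok.
    (* The sieve starts from the single class [0] modulo [1]. *)
    + left. symmetry. apply Z.mod_1_r.
    + exists g. split; [|easy]. apply in_or_app. now left.
    (* Below the final modulus a class is the base itself. *)
    + rewrite Z.mod_small in H by lia.
      destruct (not_covered_sift sporadic_table
                  (filter (fun x => 406 <=? x) (uncovered_classes 1 [0] splitting_table))
                  beta) as [(g & Hin & Hg)|H'].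
      * apply filter_In. split; [easy|]. now apply Z.leb_le.
      * exists g. split; [|easy]. apply in_or_app. now right.
      * pose proof large_bases_covered as Hl. rewrite forallb_forall in Hl.
        apply Hl, Z.ltb_lt in H'. lia.
Qed.

Theorem proposition7p2 (beta : Z) (hbeta : 2 <= beta < 1441440) :
  (~ exists a b : Z, interesting_pair beta a b) <->
  In beta [2; 3; 4; 5; 6; 7; 8; 9; 12; 15; 21].
Proof.
  split.
  - intros Hno. destruct (base_covered_or_exceptional beta hbeta) as [(g & Hg & Hc)|H];
      [|exact H].
    destruct Hno. apply (covers_interesting g); [|exact Hc].
    pose proof tables_ok as Hok. rewrite forallb_forall in Hok. now apply Hok.
  - intros H (a & b & Hab).
    (* This leaves finitely many [a], all among those evaluated for the base. *)
    pose proof (reversed_pair_summand_bound beta a b ltac:(lia) (proj1 Hab)) as Ha.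
    pose proof exceptional_bases_dead as Hd. rewrite forallb_forall in Hd.
    apply Hd, Bool.andb_true_iff in H as [_ H]. rewrite forallb_forall in H.
    specialize (H a). rewrite in_zrange, Bool.orb_true_iff, Z.eqb_eq in H.
    apply (no_summand_spec beta a b); [lia|lia| |exact Hab].
    destruct H; lia || easy.
Qed.
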